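(* Let $G$ be a countably infinite group with identity $e$ such that for each $g\in G\setminus\{e\}$ the set $\{x\in G:x^2=g\}$ is finite. Then there exists a subset $A\subseteq G$ such that $\Delta(A)=A$ but $A$ is not a subgroup of $G$.
   Context: For $A\subseteq G$, $\Delta(A)=\{g\in G:|gA\cap A|=\infty\}$. *)

(* Defs.v *)
From mathcomp Require Import all_boot all_classical.

Set Implicit Arguments.
Unset Strict Implicit.
Unset Printing Implicit Defensive.

Local Open Scope classical_set_scope.
Local Open Scope group_scope.

Definition lcoset_set (G : groupType) (g : G) (A : set G) : set G :=
  [set g * x | x in A].

(* If A is finite then Delta A = set0; in particular Delta set0 = set0 although
   set0 is not a subgroup.  A nontrivial fixed point of Delta is therefore
   required to be nonempty (and is then automatically infinite). *)
Definition Delta (G : groupType) (A : set G) : set G :=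
  [set g | infinite_set (lcoset_set g A `&` A)].

Definition is_subgroup (G : groupType) (A : set G) : Prop :=
  group_closed (mem A).

(* Main.v *)
Require Import Defs.
From mathcomp Require Import all_boot all_classical.

Local Open Scope classical_set_scope.
Local Open Scope group_scope.

(** The set [A] is an increasing union of finite symmetric sets [A_n] containing
    1.  To pass from [A_n] to [A_(n+1)] one picks [g] in [A_n] and adds [x],
    [g * x] and their inverses for a suitable [x]; if every [g] in [A] is treated
    infinitely often, then [A] is contained in [Delta A].  For the converse, [x]
    is chosen so that every product of two elements of [A_(n+1)] lying in a
    prescribed finite set [H_n] either lies in [A_n] or has both factors in
    [A_n].  Since the [H_n] exhaust [G], each [h] outside [A] is then a product of
    two elements of [A] in finitely many ways only.  Products such as [x * x]
    and [x * g * x] are controlled by the finiteness of the sets of square roots,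
    the exceptional values 1, [g] and [g^-1] being already in [A_n]; the conjugate
    [x^-1 * g * x] is [g] if [x] is taken in the centralizer of [g], and when this
    centralizer is finite, each value of the conjugate is attained finitely often.
    Finally [A] is not a subgroup since [A_0] contains some [a] and [b] whose
    product is outside [A_0] and in all the [H_n]. *)

Definition sym_unital {G : groupType} (A : set G) : Prop :=
  [/\ finite_set A, A 1 & forall y, A y -> A y^-1].

Definition block {G : groupType} (g x : G) : set G :=
  [set x; g * x; x^-1; (g * x)^-1].

(** Since [1] lies in [B], the case [z = 1] says that elements of [B] lying in [H] are already in
    [A]. *)
Definition controlled_extension {G : groupType} (H A B : set G) : Prop :=
  [/\ sym_unital B, A `<=` B
    & forall y z, B y -> B z -> H (y * z) -> A (y * z) \/ A y /\ A z].

Lemma finite_lmul_preimage {G : groupType} (K : set G) (g : G) :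
  finite_set K -> finite_set [set x | K (g * x)].
Proof.
by apply: finite_preimage => x y _ _; exact: mulgI.
Qed.

Section SquareRoots.
Context {G : groupType}.
Hypothesis finite_roots :
  forall g : G, g != 1 -> finite_set [set x : G | x ^+ 2 = g].

(** The value [1] is set aside because [finite_roots] does not bound the number of involutions. *)
Lemma finite_sqr_preimage (K : set G) :
  finite_set K -> finite_set [set x : G | K (x * x) /\ x * x <> 1].
Proof.
move=> Kfin.
apply: (@sub_finite_set _ _
  (\bigcup_(h in K `\ 1) [set x : G | x ^+ 2 = h])).
  by move=> x /= [Kx x1]; exists (x * x) => //; split.
apply: bigcup_finite; first exact: finite_setD.
by move=> h [_ /eqP]; exact: finite_roots.
Qed.

Lemma finite_conj_exceptions (g : G) (K : set G) :
    infinite_set [set: G] -> finite_set K ->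
  exists2 S : set G, infinite_set S &
    finite_set [set x | S x /\ K (x^-1 * (g * x)) /\ x^-1 * (g * x) <> g].
Proof.
move=> Ginf Kfin.
have [Cfin|Cinf] := pselect (finite_set [set x : G | g * x = x * g]); last first.
  exists [set x : G | g * x = x * g] => //.
  apply: (@sub_finite_set _ _ set0) => // x /= [-> [_]].
  by rewrite mulKg.
exists [set: G] => //.
apply: (@sub_finite_set _ _
    (\bigcup_(h in K) [set x : G | x^-1 * (g * x) = h])).
  by move=> x /= [_ [Kx _]]; exists (x^-1 * (g * x)).
apply: bigcup_finite => // h _.
have [[x0 /= x0h]|none] := pselect (exists x : G, x^-1 * (g * x) = h); last first.
  by apply: (@sub_finite_set _ _ set0) => // x xh; case: none; exists x.
(* The fibre over [h] lies in the translate by [x0] of the centralizer of [g], which is finite in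
   this case. *)
apply: (@sub_finite_set _ _ [set x | [set y | g * y = y * g] (x * x0^-1)]); last first.
  by apply: finite_preimage Cfin => x y _ _; exact: mulIg.
move=> x /= xh.
have gx : g * x = x * h by rewrite -xh mulVKg.
have gx0 : g * x0 = x0 * h by rewrite -x0h mulVKg.
have hx0 : h * x0^-1 = x0^-1 * g by rewrite -[h](mulKg x0) -gx0 !mulgA mulgK.
by rewrite mulgA gx -!mulgA hx0.
Qed.

(** Up to inversion, a product of two elements of the block is [1], [g], [x * x], [g * x * (g * x)],
    [g * x * x], [x * (g * x)] or [x^-1 * (g * x)]. Along a suitable infinite set of [x], each of
    the last five meets [K] outside the three allowed values only finitely often. *)
Lemma exists_block (Ginf : infinite_set [set: G]) (g : G) (K : set G) :
  finite_set K ->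
  exists x, [/\ forall y, block g x y -> ~ K y
    & forall y z, block g x y -> block g x z -> K (y * z) ->
        [set 1; g; g^-1] (y * z)].
Proof.
move=> K0fin.
(* Closing [K] under inverses allows products to be checked only up to inversion. *)
have [K' [Kfin KV KK']] : exists K' : set G,
    [/\ finite_set K', forall y, K' y -> K' y^-1 & K `<=` K'].
  exists (K `|` [set y^-1 | y in K]); split; last by move=> y; left.
    by rewrite finite_setU; split=> //; exact: finite_image.
  by move=> y [Ky|[z Kz <-]]; [right; exists y | left; rewrite invgK].
have [S Sinf Cfin] := finite_conj_exceptions g K' Ginf Kfin.
have sqr_l c : finite_set [set x : G | K' (c * (x * x)) /\ x * x <> 1].
  exact: finite_sqr_preimage (finite_lmul_preimage _ c Kfin).
pose sq_gx := [set x : G | [set y | K' (y * y) /\ y * y <> 1] (g * x)].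
(* [x * (g * x)] is [g^-1] times the square of [g * x], so square roots control it too. *)
pose sq_V := [set x : G |
  [set y | K' (g^-1 * (y * y)) /\ y * y <> 1] (g * x)].
pose Bad := K' `|` [set x | K' (g * x)]
  `|` [set x | K' (x * x) /\ x * x <> 1] `|` sq_gx
  `|` [set x | K' (g * (x * x)) /\ x * x <> 1] `|` sq_V
  `|` [set x | S x /\ K' (x^-1 * (g * x)) /\ x^-1 * (g * x) <> g].
have : infinite_set (S `\` Bad).
  apply: infinite_setD => //; rewrite /Bad !finite_setU.
  do !split=> //.
  - exact: (finite_lmul_preimage _ g Kfin).
  - exact: (finite_sqr_preimage _ Kfin).
  - exact: (finite_lmul_preimage _ g (finite_sqr_preimage _ Kfin)).
  - exact: (finite_lmul_preimage _ g (sqr_l g^-1)).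
move=> /infinite_setN0 [x [Sx bad]]; exists x.
set T := [set 1; g; g^-1].
have TV w : T w -> T w^-1.
  by case=> [[->|->]|->]; rewrite ?invg1 ?invgK; [left; left|right|left; right].
have Kx : ~ K' x by move=> Kx; apply: bad; do 6 left.
have Kgx : ~ K' (g * x) by move=> Kgx; apply: bad; do 5 left; right.
pose P w := K' w -> T w.
have PV w : P w -> P w^-1 by move=> Pw /KV; rewrite invgK => /Pw /TV.
have Pxx : P (x * x).
  move=> Kw; apply: contrapT => Tw; apply: bad; do 4 left; right; split=> // w1.
  by apply: Tw; rewrite w1; left; left.
have Puu : P (g * x * (g * x)).
  move=> Kw; apply: contrapT => Tw; apply: bad; do 3 left; right; split=> // w1.
  by apply: Tw; rewrite w1; left; left.
have Pux : P (g * x * x).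
  rewrite -mulgA => Kw; apply: contrapT => Tw; apply: bad; do 2 left; right.
  by split=> // w1; apply: Tw; rewrite w1 mulg1; left; right.
have Pxu : P (x * (g * x)).
  have -> : x * (g * x) = g^-1 * (g * x * (g * x)) by rewrite -[g * x * _]mulgA mulKg.
  move=> Kw; apply: contrapT => Tw; apply: bad; left; right.
  by split=> // w1; apply: Tw; rewrite w1 mulg1; right.
have PVu : P (x^-1 * (g * x)).
  move=> Kw; apply: contrapT => Tw; apply: bad; right; split=> //; split=> // w1.
  by apply: Tw; rewrite w1; left; right.
have P1 : P 1 by move=> _; left; left.
have Pg : P g by move=> _; left; right.
have PgV : P g^-1 by move=> _; right.
split.
  move=> y yX /KK'.
  by case: yX => [[[->|->]|->]|->] // /KV; rewrite invgK.
suff all y z : block g x y -> block g x z -> P (y * z).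
  by move=> y z /all yz /yz Pyz /KK'; exact: Pyz.
case=> [[[->|->]|->]|->] [[[->|->]|->]|->] //;
  rewrite ?mulgV ?mulVg ?mulgK //.
- by rewrite invgM mulVKg.
- by rewrite -invgM; exact: PV.
- by rewrite -invgM; exact: PV.
- by rewrite -[_ * x]invgK invgM invgK; exact: PV.
- by rewrite -invgM; exact: PV.
- by rewrite -invgM; exact: PV.
Qed.

Lemma exists_controlled_extension (Ginf : infinite_set [set: G])
    (H A : set G) (g : G) :
    finite_set H -> sym_unital A ->
  exists B, controlled_extension H A B /\
    (A g -> exists x, [/\ B x, B (g * x) & ~ H (g * x)]).
Proof.
move=> Hfin Aok; case: (Aok) => Afin A1 AV.
have [Ag|nAg] := pselect (A g); last first.
  by exists A; split=> //; split=> // y z Ay Az _; right.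
(* If a product of a new and an old element fell in [H], cancelling the old factor would put the new
   one in [K]. *)
pose K := H `|` [set h * a | h in H & a in A] `|` [set a * h | a in A & h in H].
have [|x [XK XX]] := exists_block Ginf g K.
  by rewrite !finite_setU; do !split=> //; exact: finite_image2.
have HK : H `<=` K by move=> h; left; left.
have XA y a : block g x y -> A a -> ~ H (y * a).
  move=> Xy Aa Hya; apply: (XK y Xy); left; right.
  by exists (y * a) => //; exists a^-1; [exact: AV | rewrite mulgK].
have AX y a : block g x y -> A a -> ~ H (a * y).
  move=> Xy Aa Hya; apply: (XK y Xy); right.
  by exists a^-1; [exact: AV | exists (a * y) => //; rewrite mulKg].
have Xgx : block g x (g * x) by left; left; right.
exists (A `|` block g x); split; last first.
  move=> _; exists x; split; [by right; left; left; left | by right|].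
  by move=> /HK; exact: XK.
split; [split | by move=> y; left |].
- rewrite !finite_setU; do !split=> //; exact: finite_set1.
- by left.
- move=> y [/AV|]; first by left.
  by case=> [[[->|->]|->]|->]; right; rewrite ?invgK;
    [left; right | right | left; left; left | left; left; right].
move=> y z [Ay|Xy] [Az|Xz] Hyz; first by right.
- by case: (AX z y).
- by case: (XA y z).
- by left; case: (XX y z Xy Xz (HK _ Hyz)) => [[->|->]|->] //; exact: AV.
Qed.

Lemma exists_controlled_chain (Ginf : infinite_set [set: G]) (H : nat -> set G)
    (e : nat -> G) (A0 : set G) :
    (forall n, finite_set (H n)) -> sym_unital A0 ->
  exists A : nat -> set G, [/\ A 0 = A0, forall n, sym_unital (A n),
    forall n, controlled_extension (H n) (A n) (A n.+1)
    & forall n, A n (e n) ->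
        exists x, [/\ A n.+1 x, A n.+1 (e n * x) & ~ H n (e n * x)]].
Proof.
move=> Hfin A0ok.
have /choice [ext extP] (p : nat * set G) : exists B, sym_unital p.2 ->
    controlled_extension (H p.1) p.2 B /\ (p.2 (e p.1) ->
      exists x, [/\ B x, B (e p.1 * x) & ~ H p.1 (e p.1 * x)]).
  (* The default [set0] only makes [ext] total; the recursion stays among symmetric sets. *)
  case: p => n A /=; have [Aok|] := pselect (sym_unital A); last by exists set0.
  have [B BP] := exists_controlled_extension Ginf _ _ (e n) (Hfin n) Aok.
  by exists B.
pose A := fix A n := if n is m.+1 then ext (m, A m) else A0.
have Aok n : sym_unital (A n).
  by elim: n => //= n IHn; have [[]] := extP (n, A n) IHn.
by exists A; split=> // n; have [] := extP (n, A n) (Aok n).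
Qed.

(** For fixed [a] other than [1], each coincidence excludes finitely many [b]; if [a * b = b^-1],
    then [a * b] is a square root of [a]. *)
Lemma exists_new_product (Ginf : infinite_set [set: G]) :
  exists a b : G, ~ [set 1; a; a^-1; b; b^-1] (a * b).
Proof.
have [a [_ /= a1]] : ([set: G] `\ 1) !=set0.
  by apply: infinite_setN0; apply: infinite_setD => //; exact: finite_set1.
have sqfin : finite_set [set b : G | (a * b) * (a * b) = a].
  apply: (finite_lmul_preimage [set y | y * y = a]).
  by apply: finite_roots; apply/eqP.
have [b [_ /= bad]] : ([set: G] `\` ([set 1; a^-1; a^-1 * a^-1]
    `|` [set b : G | (a * b) * (a * b) = a])) !=set0.
  apply: infinite_setN0; apply: infinite_setD => //.
  by rewrite finite_setU; split=> //; exact: finite_set3.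
exists a, b => prod; apply: bad.
case: prod => [[[[ab1|aba]|abV]|abb]|abVb].
- by left; left; right; rewrite -[b](mulKg a) ab1 mulg1.
- by left; left; left; rewrite -[b](mulKg a) aba mulVg.
- by left; right; rewrite -[b](mulKg a) abV.
- by case: a1; rewrite -[a](mulgK b) abb mulgV.
- by right; rewrite /= {2}abVb mulgK.
Qed.

End SquareRoots.

Theorem theorem5p4 (G : groupType)
    (G_countable : countable [set: G]) (G_infinite : infinite_set [set: G])
    (finite_roots : forall g : G, g != 1 -> finite_set [set x : G | x ^+ 2 = g]) :
  exists A : set G, [/\ A !=set0, Delta A = A & ~ is_subgroup A].
Proof.
have /countable_injP [code code_inj'] := G_countable.
have code_inj : injective code by move=> x y; apply: code_inj'; rewrite inE.
have [a [b ab]] := exists_new_product finite_roots G_infinite.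
(* The shift puts [a * b] in every [H n], starting with [H 0]. *)
pose H n := code @^-1` `I_(n + (code (a * b)%g).+1).
have Hfin n : finite_set (H n).
  apply: finite_preimage; last exact: finite_II.
  by move=> x y _ _; exact: code_inj.
have Hle m n : m <= n -> H m `<=` H n.
  by move=> mn h /leq_trans; apply; rewrite leq_add2r.
have HN h : H (code h) h by rewrite /H /= addnS ltnS leq_addr.
have [e eP] : exists e : nat -> G, forall g N, exists2 n, N <= n & e n = g.
  have /choice [dec decP] (c : nat) : exists x : G, forall y, code y = c -> x = y.
    have [[x <-]|none] := pselect (exists x : G, code x = c).
      by exists x => y /code_inj.
    by exists 1 => y yc; case: none; exists y.
  (* The exponent of 2 in [n] encodes the element; the odd cofactor is free, so [n] can be made
     large. *)
  exists (fun n => dec (logn 2 n)) => g N.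
  exists (2 ^ code g * N.*2.+1)%N; first last.
    apply: decP; rewrite lognM ?expn_gt0 // pfactorK // lognE /= dvdn2 /=.
    by rewrite odd_double /= addn0.
  rewrite (leq_trans _ (leq_pmull _ _)) ?expn_gt0 //.
  by rewrite -addnn -addnS leq_addr.
have [|A [A0 Aok Aext Atrans]] := exists_controlled_chain finite_roots G_infinite H e
    [set 1; a; a^-1; b; b^-1] Hfin.
  split; [exact: finite_set5 | by do 4 left |].
  move=> y; case=> [[[[->|->]|->]|->]|->]; rewrite ?invg1 ?invgK.
  - by do 4 left.
  - by do 2 left; right.
  - by do 3 left; right.
  - by right.
  - by left; right.
have Amono m n : m <= n -> A m `<=` A n.
  move=> /subnK <-; elim: (n - m) => // k IHk x /IHk.
  by have [_ + _] := Aext (k + m); apply.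
have A1 n : A n 1 by have [] := Aok n.
pose U := [set x | exists n, A n x].
have UV x : U x -> U x^-1 by case=> n; have [_ _ AV] := Aok n; exists n; exact: AV.
exists U; split; first by exists 1, 0.
- apply/seteqP; split=> g; last first.
    move=> [k Akg] Dfin.
    have /(@finite_image _ _ _ code) /finite_fsetP [F FE] := Dfin.
    (* [N] bounds all codes in the supposedly finite intersection, whereas a stage [n >= N] treating
       [g] adds [g * x] outside [H n], hence of larger code. *)
    pose N := \max_(c <- finmap.enum_fset F) c.
    have [n Nn eng] := eP g (maxn k N).
    have [|x [Ax Agx]] := Atrans n.
      by rewrite eng; apply: Amono Akg; exact: leq_trans (leq_maxl _ _) Nn.
    rewrite eng in Agx *; case.
    have : [set code i | i in lcoset_set g U `&` U] (code (g * x)).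
      exists (g * x) => //; split; [exists x => //|]; by exists n.+1.
    rewrite FE => Fgx; rewrite /H /= addnS ltnS.
    rewrite (leq_trans _ (leq_addr _ _)) // (leq_trans _ Nn) //.
    rewrite (leq_trans _ (leq_maxr _ _)) //.
    exact: (@leq_bigmax_seq _ _ xpredT id).
  move=> gD; apply: contrapT => gU; apply: gD.
  (* From stage [code g] on, [g] is in [H m] but never in [A m], so control pushes both factors down
     one stage at a time. *)
  have bound m y z : A m y -> A m z -> y * z = g -> A (code g) y.
    elim: m y z => [|m IHm] y z Ay Az yzg; first exact: Amono Ay.
    have [mg|gm] := ltnP m (code g); first exact: Amono Ay.
    have [_ _ ctl] := Aext m.
    case: (ctl y z Ay Az); rewrite ?yzg.
    + by apply: Hle (HN g).
    + by move=> Ag; case: gU; exists m.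
    + by move=> [Ay' Az']; exact: IHm Az' yzg.
  apply: (@sub_finite_set _ _ (A (code g))); last by have [] := Aok (code g).
  move=> y [[z Uz <-{y}] [m Am]].
  have [p Ap] := UV z Uz.
  apply: (bound (maxn m p) _ z^-1); last by rewrite mulgK.
    by apply: Amono Am; exact: leq_maxl.
  by apply: Amono Ap; exact: leq_maxr.
- move=> /group_closedM UM.
  have [n Anab] : U (a * b).
    apply: set_mem; apply: UM.
      by apply: mem_set; exists 0; rewrite A0; do 3 left; right.
    by apply: mem_set; exists 0; rewrite A0; left; right.
  elim: n Anab => [|n IHn]; first by rewrite A0.
  move=> Aab; apply: IHn; have [_ _ ctl] := Aext n.
  (* With second factor [1], control brings [a * b] down from [A n.+1] to [A n], and finally to
     [A 0], which omits it. *)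
  case: (ctl (a * b) 1 Aab (A1 _)); rewrite ?mulg1 //; last by case.
  by rewrite /H /= addnS ltnS leq_addl.
Qed.
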